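(* Let $\alpha,\beta,\gamma\in\mathbb{R}\setminus\{0\}$. The algebra $\mathbb{O}(\alpha,\beta,\gamma)$ is isomorphic to $\mathbb{O}(1,1,1)$ or to $\mathbb{O}(1,1,-1)$. More precisely, the isomorphism is given by the following relations, according to the signs of $\alpha,\beta,\gamma$. (1) If $\alpha,\beta,\gamma>0$, then $\mathbb{O}(\alpha,\beta,\gamma)$ is isomorphic to $\mathbb{O}(1,1,1)$, and the isomorphism is given by $A_1:\ f_1\mapsto\widetilde{f_1}\sqrt{\alpha},\ f_2\mapsto\widetilde{f_2}\sqrt{\beta},\ f_3\mapsto\widetilde{f_3}\sqrt{\alpha\beta},\ f_4\mapsto\widetilde{f_4}\sqrt{\gamma},\ f_5\mapsto\widetilde{f_5}\sqrt{\alpha\gamma},\ f_6\mapsto\widetilde{f_6}\sqrt{\beta\gamma},\ f_7\mapsto\widetilde{f_7}\sqrt{\alpha\beta\gamma}$. In each of the remaining cases $\mathbb{O}(\alpha,\beta,\gamma)$ is isomorphic to $\mathbb{O}(1,1,-1)$, and the isomorphism is given by the indicated relations. (2) If $\alpha,\beta>0$, $\gamma<0$: $A_2:\ f_1\mapsto\widehat{f_1}\sqrt{\alpha},\ f_2\mapsto\widehat{f_2}\sqrt{\beta},\ f_3\mapsto\widehat{f_3}\sqrt{\alpha\beta},\ f_4\mapsto\widehat{f_4}\sqrt{-\gamma},\ f_5\mapsto\widehat{f_5}\sqrt{-\alpha\gamma},\ f_6\mapsto\widehat{f_6}\sqrt{-\beta\gamma},\ f_7\mapsto\widehat{f_7}\sqrt{-\alpha\beta\gamma}$.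 (3) If $\alpha,\gamma>0$, $\beta<0$: $A_3:\ f_1\mapsto\widehat{f_1}\sqrt{\alpha},\ f_2\mapsto\widehat{f_4}\sqrt{-\beta},\ f_3\mapsto\widehat{f_5}\sqrt{-\alpha\beta},\ f_4\mapsto\widehat{f_2}\sqrt{\gamma},\ f_5\mapsto\widehat{f_3}\sqrt{\alpha\gamma},\ f_6\mapsto\widehat{f_6}\sqrt{-\beta\gamma},\ f_7\mapsto\widehat{f_7}\sqrt{-\alpha\beta\gamma}$. (4) If $\alpha>0$, $\beta,\gamma<0$: $A_4:\ f_1\mapsto\widehat{f_1}\sqrt{\alpha},\ f_2\mapsto\widehat{f_4}\sqrt{-\beta},\ f_3\mapsto\widehat{f_5}\sqrt{-\alpha\beta},\ f_4\mapsto\widehat{f_6}\sqrt{-\gamma},\ f_5\mapsto\widehat{f_7}\sqrt{-\alpha\gamma},\ f_6\mapsto\widehat{f_2}\sqrt{\beta\gamma},\ f_7\mapsto\widehat{f_3}\sqrt{\alpha\beta\gamma}$. (5) If $\alpha<0$, $\beta,\gamma>0$: $A_5:\ f_1\mapsto\widehat{f_4}\sqrt{-\alpha},\ f_2\mapsto\widehat{f_1}\sqrt{\beta},\ f_3\mapsto\widehat{f_5}\sqrt{-\alpha\beta},\ f_4\mapsto\widehat{f_2}\sqrt{\gamma},\ f_5\mapsto\widehat{f_6}\sqrt{-\alpha\gamma},\ f_6\mapsto\widehat{f_3}\sqrt{\beta\gamma},\ f_7\mapsto\widehat{f_7}\sqrt{-\alpha\beta\gamma}$. (6) If $\alpha,\gamma<0$,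 $\beta>0$: $A_6:\ f_1\mapsto\widehat{f_4}\sqrt{-\alpha},\ f_2\mapsto\widehat{f_1}\sqrt{\beta},\ f_3\mapsto\widehat{f_5}\sqrt{-\alpha\beta},\ f_4\mapsto\widehat{f_6}\sqrt{-\gamma},\ f_5\mapsto\widehat{f_2}\sqrt{\alpha\gamma},\ f_6\mapsto\widehat{f_7}\sqrt{-\beta\gamma},\ f_7\mapsto\widehat{f_3}\sqrt{\alpha\beta\gamma}$. (7) If $\alpha,\beta<0$, $\gamma>0$: $A_7:\ f_1\mapsto\widehat{f_4}\sqrt{-\alpha},\ f_2\mapsto\widehat{f_5}\sqrt{-\beta},\ f_3\mapsto\widehat{f_1}\sqrt{\alpha\beta},\ f_4\mapsto\widehat{f_2}\sqrt{\gamma},\ f_5\mapsto\widehat{f_6}\sqrt{-\alpha\gamma},\ f_6\mapsto\widehat{f_7}\sqrt{-\beta\gamma},\ f_7\mapsto\widehat{f_3}\sqrt{\alpha\beta\gamma}$. (8) If $\alpha,\beta,\gamma<0$: $A_8:\ f_1\mapsto\widehat{f_4}\sqrt{-\alpha},\ f_2\mapsto\widehat{f_5}\sqrt{-\beta},\ f_3\mapsto\widehat{f_1}\sqrt{\alpha\beta},\ f_4\mapsto\widehat{f_6}\sqrt{-\gamma},\ f_5\mapsto\widehat{f_2}\sqrt{\alpha\gamma},\ f_6\mapsto\widehat{f_3}\sqrt{\beta\gamma},\ f_7\mapsto\widehat{f_7}\sqrt{-\alpha\beta\gamma}$.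
   Context: For $\alpha,\beta,\gamma\in\mathbb{R}\setminus\{0\}$, the generalized octonion algebra $\mathbb{O}(\alpha,\beta,\gamma)$ is the unital (non-associative) real algebra with basis $\{1,f_1,\dots,f_7\}$, unit $1$, with $f_1^2=-\alpha$, $f_2^2=-\beta$, $f_3^2=-\alpha\beta$, $f_4^2=-\gamma$, $f_5^2=-\alpha\gamma$, $f_6^2=-\beta\gamma$, $f_7^2=-\alpha\beta\gamma$, with $f_pf_q=-f_qf_p$ for $p\neq q$, and $f_1f_2=f_3$, $f_1f_3=-\alpha f_2$, $f_1f_4=f_5$, $f_1f_5=-\alpha f_4$, $f_1f_6=-f_7$, $f_1f_7=\alpha f_6$, $f_2f_3=\beta f_1$, $f_2f_4=f_6$, $f_2f_5=f_7$, $f_2f_6=-\beta f_4$, $f_2f_7=-\beta f_5$, $f_3f_4=f_7$, $f_3f_5=-\alpha f_6$, $f_3f_6=\beta f_5$, $f_3f_7=-\alpha\beta f_4$, $f_4f_5=\gamma f_1$, $f_4f_6=\gamma f_2$, $f_4f_7=\gamma f_3$, $f_5f_6=-\gamma f_3$, $f_5f_7=\alpha\gamma f_2$, $f_6f_7=-\beta\gamma f_1$. The canonical basis of this kind is denoted $\{1,\widetilde{f_1},\dots,\widetilde{f_7}\}$ in $\mathbb{O}(1,1,1)$ and $\{1,\widehat{f_1},\dots,\widehat{f_7}\}$ in $\mathbb{O}(1,1,-1)$. Each $A_k$ denotes the real-linear map with $1\mapsto 1$ and the listed values on $f_1,\dots,f_7$.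
   Formalization: As printed, the maps in (3)–(8) are not multiplicative; the theorem puts a minus sign on the images of f6,f7 in A3; f5,f6 in A4; f3,f5 in A5 and A8; and f3,f5,f6,f7 in A6 and A7, all else as printed. *)

(* Defs.v *)
From mathcomp Require Import all_boot all_order all_algebra.
From mathcomp Require Import reals.
Set Implicit Arguments.
Unset Strict Implicit.
Unset Printing Implicit Defensive.
Import Order.TTheory GRing.Theory Num.Theory.
Local Open Scope ring_scope.

(* Associativity is not required, hence none of the algebra structures of
   ssralg applies to the octonions. *)
Record unitalAlg (R : pzRingType) := UnitalAlg {
  ua_sort :> lmodType R;
  ua_one : ua_sort;
  ua_mul : ua_sort -> ua_sort -> ua_sort;
  ua_mul1l : left_id ua_one ua_mul;
  ua_mul1r : right_id ua_one ua_mul;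
  ua_mul_linearl : forall y, linear (ua_mul^~ y);
  ua_mul_linearr : forall x, linear (ua_mul x)
}.

Definition alg_iso (R : pzRingType) (A B : unitalAlg R) (h : A -> B) : Prop :=
  [/\ linear h, bijective h, h (ua_one A) = ua_one B &
      forall x y, h (ua_mul x y) = ua_mul (h x) (h y)].

Definition alg_isomorphic (R : pzRingType) (A B : unitalAlg R) : Prop :=
  exists h : A -> B, alg_iso h.

Section GeneralizedOctonions.
Variables (R : realType) (a b c : R).

(* oct_e 0 is the unit 1, and oct_e k is f_k for 1 <= k <= 7. *)
Definition oct_e (k : nat) : 'rV[R]_8 := delta_mx 0 (inord k).

Section MultiplicationTable.
Local Open Scope nat_scope.

(* f_p ^ 2 = oct_sq p *)
Definition oct_sq (p : nat) : R :=
  match p with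
  | 1 => - a
  | 2 => - b
  | 3 => - (a * b)
  | 4 => - c
  | 5 => - (a * c)
  | 6 => - (b * c)
  | 7 => - (a * b * c)
  | _ => 0
  end%R.

(* f_p f_q for 1 <= p < q <= 7 *)
Definition oct_lt (p q : nat) : 'rV[R]_8 :=
  match p, q with
  | 1, 2 => oct_e 3
  | 1, 3 => - a *: oct_e 2
  | 1, 4 => oct_e 5
  | 1, 5 => - a *: oct_e 4
  | 1, 6 => - oct_e 7
  | 1, 7 => a *: oct_e 6
  | 2, 3 => b *: oct_e 1
  | 2, 4 => oct_e 6
  | 2, 5 => oct_e 7
  | 2, 6 => - b *: oct_e 4
  | 2, 7 => - b *: oct_e 5
  | 3, 4 => oct_e 7
  | 3, 5 => - a *: oct_e 6
  | 3, 6 => b *: oct_e 5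
  | 3, 7 => - (a * b) *: oct_e 4
  | 4, 5 => c *: oct_e 1
  | 4, 6 => c *: oct_e 2
  | 4, 7 => c *: oct_e 3
  | 5, 6 => - c *: oct_e 3
  | 5, 7 => (a * c) *: oct_e 2
  | 6, 7 => - (b * c) *: oct_e 1
  | _, _ => 0
  end%R.

Definition oct_tab (p q : nat) : 'rV[R]_8 :=
  if p == 0 then oct_e q
  else if q == 0 then oct_e p
  else if p == q then (oct_sq p *: oct_e 0)%R
  else if p < q then oct_lt p q
  else (- oct_lt q p)%R.

End MultiplicationTable.

Definition oct_mul (x y : 'rV[R]_8) : 'rV[R]_8 :=
  \sum_(p < 8) \sum_(q < 8) (x 0 p * y 0 q) *: oct_tab p q.

Lemma oct_sum_e (x : 'rV[R]_8) : x = \sum_(p < 8) x 0 p *: oct_e p.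
Proof.
rewrite {1}[x]row_sum_delta; apply: eq_bigr => p _.
by rewrite /oct_e inord_val.
Qed.

Lemma oct_eE (p q : 'I_8) : oct_e p 0 q = (q == p)%:R.
Proof. by rewrite /oct_e inord_val mxE. Qed.

Lemma oct_mul1l : left_id (oct_e 0) oct_mul.
Proof.
move=> x; rewrite /oct_mul (bigD1 ord0) //= [X in _ + X]big1 ?addr0.
  rewrite {2}[x]oct_sum_e; apply: eq_bigr => q _.
  by rewrite (oct_eE ord0) eqxx mul1r.
move=> p /negbTE np; apply: big1 => q _.
by rewrite (oct_eE ord0) np mul0r scale0r.
Qed.

Lemma oct_mul1r : right_id (oct_e 0) oct_mul.
Proof.
move=> x; rewrite /oct_mul {2}[x]oct_sum_e; apply: eq_bigr => p _.
rewrite (bigD1 ord0) //= [X in _ + X]big1 ?addr0.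
  rewrite (oct_eE ord0) eqxx mulr1 /oct_tab /=.
  by case: eqP => [->|].
by move=> q /negbTE nq; rewrite (oct_eE ord0) nq mulr0 scale0r.
Qed.

Lemma oct_mul_linearl (y : 'rV[R]_8) : linear (oct_mul^~ y).
Proof.
move=> k x x'; rewrite /oct_mul scaler_sumr -big_split; apply: eq_bigr => p _.
rewrite scaler_sumr -big_split; apply: eq_bigr => q _ /=.
by rewrite !mxE mulrDl scalerDl scalerA mulrA.
Qed.

Lemma oct_mul_linearr (x : 'rV[R]_8) : linear (oct_mul x).
Proof.
move=> k y y'; rewrite /oct_mul scaler_sumr -big_split; apply: eq_bigr => p _.
rewrite scaler_sumr -big_split; apply: eq_bigr => q _ /=.
by rewrite !mxE mulrDr scalerDl scalerA mulrCA.
Qed.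

(* The generalized octonion algebra O(a, b, c). *)
Definition oct : unitalAlg R :=
  @UnitalAlg R 'rV[R]_8 (oct_e 0) oct_mul
    oct_mul1l oct_mul1r oct_mul_linearl oct_mul_linearr.

Definition oct_f (k : nat) : oct := oct_e k.

(* The linear map sending 1 to 1 and f_k to the k-th entry of v, k = 1..7. *)
Definition oct_ext (B : unitalAlg R) (v : 7.-tuple B) (x : oct) : B :=
  (x : 'rV_8) 0 0 *: ua_one B
  + \sum_(k < 7) (x : 'rV_8) 0 (lift 0 k) *: tnth v k.

Lemma oct_ext_linear (B : unitalAlg R) (v : 7.-tuple B) : linear (oct_ext v).
Proof.
move=> k x y; rewrite /oct_ext !mxE scalerDr scalerDl -!addrA scalerA.
congr (_ + _); rewrite addrCA; congr (_ + _).
rewrite scaler_sumr -big_split; apply: eq_bigr => i _ /=.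
by rewrite !mxE scalerDl scalerA.
Qed.

Lemma oct_ext1 (B : unitalAlg R) (v : 7.-tuple B) :
  oct_ext v (ua_one oct) = ua_one B.
Proof.
rewrite /oct_ext (oct_eE ord0 ord0) scale1r big1 ?addr0 // => i _.
by rewrite (oct_eE ord0) scale0r.
Qed.

Lemma oct_ext_f (B : unitalAlg R) (v : 7.-tuple B) (k : 'I_7) :
  oct_ext v (oct_f k.+1) = tnth v k.
Proof.
rewrite /oct_ext /oct_f -[k.+1]/(nat_of_ord (lift ord0 k)).
rewrite (oct_eE (lift ord0 k) ord0) scale0r add0r (bigD1 k) //=.
rewrite (oct_eE (lift ord0 k)) eqxx scale1r big1 ?addr0 // => i /negbTE ni.
by rewrite (oct_eE (lift ord0 k)) (inj_eq lift_inj) ni scale0r.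
Qed.

End GeneralizedOctonions.

Section CanonicalMaps.
Variables (R : realType) (a b c : R).

Local Notation ft := (@oct_f R 1 1 1).
Local Notation fh := (@oct_f R 1 1 (-1)).

(* The source lists the values of octA3, ..., octA8 below without minus signs.
   Without them these maps are not multiplicative: f_2 f_4 = f_6 in the domain
   of octA3, whereas fh 4 * fh 2 = - fh 6.  The values on f_1, f_2, f_4, which
   generate the algebra, are those of the source, and they force the signs of
   the values on f_3, f_5, f_6, f_7. *)
Definition octA1 : oct a b c -> oct 1 1 1 :=
  oct_ext [tuple
    Num.sqrt a *: ft 1;
    Num.sqrt b *: ft 2;
    Num.sqrt (a * b) *: ft 3;
    Num.sqrt c *: ft 4;
    Num.sqrt (a * c) *: ft 5;
    Num.sqrt (b * c) *: ft 6;
    Num.sqrt (a * b * c) *: ft 7].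

Definition octA2 : oct a b c -> oct 1 1 (-1) :=
  oct_ext [tuple
    Num.sqrt a *: fh 1;
    Num.sqrt b *: fh 2;
    Num.sqrt (a * b) *: fh 3;
    Num.sqrt (- c) *: fh 4;
    Num.sqrt (- (a * c)) *: fh 5;
    Num.sqrt (- (b * c)) *: fh 6;
    Num.sqrt (- (a * b * c)) *: fh 7].

Definition octA3 : oct a b c -> oct 1 1 (-1) :=
  oct_ext [tuple
    Num.sqrt a *: fh 1;
    Num.sqrt (- b) *: fh 4;
    Num.sqrt (- (a * b)) *: fh 5;
    Num.sqrt c *: fh 2;
    Num.sqrt (a * c) *: fh 3;
    - (Num.sqrt (- (b * c)) *: fh 6);
    - (Num.sqrt (- (a * b * c)) *: fh 7)].

Definition octA4 : oct a b c -> oct 1 1 (-1) :=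
  oct_ext [tuple
    Num.sqrt a *: fh 1;
    Num.sqrt (- b) *: fh 4;
    Num.sqrt (- (a * b)) *: fh 5;
    Num.sqrt (- c) *: fh 6;
    - (Num.sqrt (- (a * c)) *: fh 7);
    - (Num.sqrt (b * c) *: fh 2);
    Num.sqrt (a * b * c) *: fh 3].

Definition octA5 : oct a b c -> oct 1 1 (-1) :=
  oct_ext [tuple
    Num.sqrt (- a) *: fh 4;
    Num.sqrt b *: fh 1;
    - (Num.sqrt (- (a * b)) *: fh 5);
    Num.sqrt c *: fh 2;
    - (Num.sqrt (- (a * c)) *: fh 6);
    Num.sqrt (b * c) *: fh 3;
    Num.sqrt (- (a * b * c)) *: fh 7].

Definition octA6 : oct a b c -> oct 1 1 (-1) :=
  oct_ext [tuple
    Num.sqrt (- a) *: fh 4;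
    Num.sqrt b *: fh 1;
    - (Num.sqrt (- (a * b)) *: fh 5);
    Num.sqrt (- c) *: fh 6;
    - (Num.sqrt (a * c) *: fh 2);
    - (Num.sqrt (- (b * c)) *: fh 7);
    - (Num.sqrt (a * b * c) *: fh 3)].

Definition octA7 : oct a b c -> oct 1 1 (-1) :=
  oct_ext [tuple
    Num.sqrt (- a) *: fh 4;
    Num.sqrt (- b) *: fh 5;
    - (Num.sqrt (a * b) *: fh 1);
    Num.sqrt c *: fh 2;
    - (Num.sqrt (- (a * c)) *: fh 6);
    - (Num.sqrt (- (b * c)) *: fh 7);
    - (Num.sqrt (a * b * c) *: fh 3)].

Definition octA8 : oct a b c -> oct 1 1 (-1) :=
  oct_ext [tuple
    Num.sqrt (- a) *: fh 4;
    Num.sqrt (- b) *: fh 5;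
    - (Num.sqrt (a * b) *: fh 1);
    Num.sqrt (- c) *: fh 6;
    - (Num.sqrt (a * c) *: fh 2);
    Num.sqrt (b * c) *: fh 3;
    Num.sqrt (- (a * b * c)) *: fh 7].

End CanonicalMaps.

Arguments octA1 {R} a b c x.
Arguments octA2 {R} a b c x.
Arguments octA3 {R} a b c x.
Arguments octA4 {R} a b c x.
Arguments octA5 {R} a b c x.
Arguments octA6 {R} a b c x.
Arguments octA7 {R} a b c x.
Arguments octA8 {R} a b c x.

(* Main.v *)
Require Import Defs.
From HB Require Import structures.
From mathcomp Require Import all_boot all_order all_algebra.
From mathcomp Require Import reals.
From mathcomp Require Import ring.
Import Order.TTheory GRing.Theory Num.Theory.
Local Open Scope ring_scope.

(** Writing an index p < 8 in binary, p = p0 + 2 p1 + 4 p2, turns the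
    multiplication table into a twisted group algebra of (Z/2)^3:
      f_p f_q = (-1)^t(p,q) a^(p0 q0) b^(p1 q1) c^(p2 q2) f_(p xor q),
    where t is a cubic polynomial over Z/2 ([oct_tabE]).  If a, b, c are
    (-1)^ea x^2, (-1)^eb y^2, (-1)^ec z^2 with x, y, z > 0, each of the eight
    maps sends f_p to
      (-1)^n(p) x^p0 y^p1 z^p2 f_(s p)
    for a permutation s of the indices and exponents n of -1.  The powers of x, y, z on
    the two sides of the multiplicativity condition agree for all p and q, so
    such a map is an isomorphism onto O(1, 1, (-1)^d) as soon as s preserves
    xor and a condition on the signs holds, both being finite statements about
    bits ([signed_perm_iso]).  They are decided by computation in each of the
    eight cases; what remains is that the square root of each product of
    parameters is the corresponding product of x, y, z. *)

(** * Linear maps determined by the basis *)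

Section LinearExtension.
Variables (R : realType).

Lemma linear_oct_sum (V : lmodType R) (h : 'rV[R]_8 -> V) (x : 'rV[R]_8) :
  linear h -> h x = \sum_(p < 8) x 0 p *: h (oct_e R p).
Proof.
move=> hl.
pose H : {linear 'rV[R]_8 -> V} :=
  HB.pack h (GRing.isLinear.Build R 'rV[R]_8 V *:%R h hl).
rewrite -[h]/(H : _ -> _) {1}[x]oct_sum_e linear_sum.
by apply: eq_bigr => p _; rewrite linearZ.
Qed.

Lemma linear_oct_ext (V : lmodType R) (f g : 'rV[R]_8 -> V) :
  linear f -> linear g ->
  (forall p : 'I_8, f (oct_e R p) = g (oct_e R p)) -> f =1 g.
Proof.
move=> fl gl fg x; rewrite (linear_oct_sum _ _ _ fl) (linear_oct_sum _ _ _ gl).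
by apply: eq_bigr => p _; rewrite fg.
Qed.

Lemma linear_scale (U V : lmodType R) (f : U -> V) (k : R) (u : U) :
  linear f -> f (k *: u) = k *: f u.
Proof. by move=> fl; apply: (scalable_linear fl). Qed.

(** Both sides are bilinear in x and y, hence determined by their values on the
    basis. *)
Lemma oct_multiplicative (a b c : R) (B : unitalAlg R) (h : oct a b c -> B) :
  linear h ->
  (forall p q : 'I_8, h (ua_mul (oct_f a b c p) (oct_f a b c q)) =
                      ua_mul (h (oct_f a b c p)) (h (oct_f a b c q))) ->
  forall x y, h (ua_mul x y) = ua_mul (h x) (h y).
Proof.
move=> hl hb x y.
refine (linear_oct_ext B (fun u : oct a b c => h (ua_mul u y))
                         (fun u : oct a b c => ua_mul (h u) (h y)) _ _ _ x).
- by move=> k u v; rewrite ua_mul_linearl hl.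
- by move=> k u v; rewrite hl ua_mul_linearl.
move=> p.
refine (linear_oct_ext B
          (fun v : oct a b c => h (ua_mul (oct_f a b c p) v))
          (fun v : oct a b c => ua_mul (h (oct_f a b c p)) (h v)) _ _ _ y).
- by move=> k u v; rewrite ua_mul_linearr hl.
- by move=> k u v; rewrite hl ua_mul_linearr.
by move=> q; apply: hb.
Qed.

(** The matrix of [h] has exactly one nonzero entry in each row and in each
    column, so the inverse is obtained by permuting back and dividing. *)
Lemma monomial_bijective (h : 'rV[R]_8 -> 'rV[R]_8) (s : 'I_8 -> 'I_8)
    (w : 'I_8 -> R) :
  linear h -> injective s -> (forall p, w p != 0) ->
  (forall p : 'I_8, h (oct_e R p) = w p *: oct_e R (s p)) -> bijective h.
Proof.
move=> hl /injF_bij[r sK rK] w0 hb.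
have hE x : h x = \row_j (x 0 (r j) * w (r j)).
  refine (linear_oct_ext _ h (fun x => \row_j (x 0 (r j) * w (r j))) _ _ _ x).
  - by [].
    by move=> k u v; apply/rowP=> j; rewrite !mxE mulrDl mulrA.
  move=> p; rewrite hb; apply/rowP=> j; rewrite !mxE !inord_val !eqxx /=.
  rewrite (eq_sym j) (can2_eq sK rK) (eq_sym p) mulrC.
  by case: eqP => [->|]; rewrite ?sK // !mul0r.
exists (fun y : 'rV[R]_8 => \row_p (y 0 (s p) / w p)) => x; apply/rowP=> j.
  by rewrite hE !mxE sK mulfK.
by rewrite hE !mxE rK mulfVK.
Qed.

End LinearExtension.

(** * The multiplication table as a twisted group algebra *)

Definition bit (i k : nat) : bool := odd (k %/ 2 ^ i).

Definition xor8 (p q : nat) : nat :=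
  ((bit 0 p (+) bit 0 q) + 2 * (bit 1 p (+) bit 1 q)
   + 4 * (bit 2 p (+) bit 2 q))%N.

(** The exponent of -1 in f_p f_q when the parameters are 1.  It is the sum of
    p_i q_j over i >= j, plus p_i q_j q_k over the three ways of splitting
    {0, 1, 2} into {i} and {j, k}; the quadratic part alone would give an associative algebra,
    and the cubic terms are responsible for the associator. *)
Definition oct_sign (p q : nat) : bool :=
  (bit 0 p && bit 0 q) (+) (bit 1 p && bit 0 q) (+)
  (bit 2 p && bit 0 q) (+) (bit 1 p && bit 1 q) (+)
  (bit 2 p && bit 1 q) (+) (bit 2 p && bit 2 q) (+)
  [&& bit 2 p, bit 0 q & bit 1 q] (+) [&& bit 1 p, bit 0 q & bit 2 q] (+)
  [&& bit 0 p, bit 1 q & bit 2 q].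

Lemma bit_xor8 (i p q : nat) :
  (i < 3)%N -> bit i (xor8 p q) = bit i p (+) bit i q.
Proof.
rewrite /xor8; case: i => [|[|[|]]] // _.
- by do 3!case: (_ (+) _).
- by do 3!case: (_ (+) _).
- by do 3!case: (_ (+) _).
Qed.

Lemma xor8_lt8 (p q : nat) : (xor8 p q < 8)%N.
Proof. by rewrite /xor8; do 3!case: (_ (+) _). Qed.

Lemma oct_tabE (R : realType) (a b c : R) (p q : nat) :
  (p < 8)%N -> (q < 8)%N ->
  oct_tab a b c p q =
    ((-1) ^+ oct_sign p q * (a ^+ (bit 0 p && bit 0 q)
      * b ^+ (bit 1 p && bit 1 q) * c ^+ (bit 2 p && bit 2 q)))
    *: oct_e R (xor8 p q).
Proof.
do 8?[case: p => [|p]] => //; do 8?[case: q => [|q]] => // _ _;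
  rewrite /oct_tab /oct_sign /bit /xor8 /= ?(expr0, expr1);
  by rewrite ?(mul1r, mulr1, mulN1r, scale1r, scaleN1r, scaleNr, opprK).
Qed.

Lemma oct_mul_e (R : realType) (a b c : R) (p q : nat) :
  (p < 8)%N -> (q < 8)%N ->
  oct_mul a b c (oct_e R p) (oct_e R q) = oct_tab a b c p q.
Proof.
move=> p8 q8; rewrite /oct_mul (bigD1 (Ordinal p8)) //= [X in _ + X]big1.
  rewrite addr0 (bigD1 (Ordinal q8)) //= [X in _ + X]big1 ?addr0.
    rewrite (oct_eE _ (Ordinal p8)) (oct_eE _ (Ordinal q8)).
    by rewrite !eqxx mulr1 scale1r.
  by move=> j /negbTE nj; rewrite (oct_eE _ (Ordinal q8)) nj mulr0 scale0r.
move=> i /negbTE ni; apply: big1 => j _.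
by rewrite (oct_eE _ (Ordinal p8)) ni mul0r scale0r.
Qed.

(** * Signed permutations of the basis *)

(** The isomorphism condition for f_p |-> (-1)^(n p) f_(s p), from
    O((-1)^ea, (-1)^eb, (-1)^ec) to O(1, 1, (-1)^d), on exponents of -1. *)
Definition signed_perm_hom (ea eb ec d : bool) (s : seq nat) (n : seq bool) :=
  perm_eq s (iota 0 8) &&
  all (fun p => all (fun q =>
    (nth 0%N s (xor8 p q) == xor8 (nth 0%N s p) (nth 0%N s q)) &&
    (oct_sign p q (+) [&& ea, bit 0 p & bit 0 q] (+)
       [&& eb, bit 1 p & bit 1 q] (+) [&& ec, bit 2 p & bit 2 q] (+)
       nth false n (xor8 p q)
     == nth false n p (+) nth false n q (+)
       oct_sign (nth 0%N s p) (nth 0%N s q) (+)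
       [&& d, bit 2 (nth 0%N s p) & bit 2 (nth 0%N s q)]))
    (iota 0 8)) (iota 0 8).

(** With carries: p + q = (p xor q) + 2 p q for bits p and q. *)
Lemma sqr_expr_addb (R : comPzRingType) (x : R) (e p q : bool) :
  ((-1) ^+ e * x ^+ 2) ^+ (p && q) * x ^+ (p (+) q) =
  (-1) ^+ [&& e, p & q] * (x ^+ p * x ^+ q).
Proof.
by case: p; case: q; case: e;
  rewrite /= ?(expr0, expr1) ?(mul1r, mulr1) // -expr2.
Qed.

(** Here S A B C and S' D are the structure constants of the source and of the
    target, split into the sign given by the table and the contribution of each
    parameter; N X Y Z, n1 p0 p1 p2 and n2 q0 q1 q2 are the weights at p xor q,
    p and q. *)
Lemma collect_signs (R : comPzRingType)
    (S S' D N n1 n2 a b c A B C X Y Z p0 p1 p2 q0 q1 q2 : R) :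
  A * X = a * (p0 * q0) -> B * Y = b * (p1 * q1) -> C * Z = c * (p2 * q2) ->
  S * a * b * c * N = n1 * n2 * S' * D ->
  S * (A * B * C) * (N * (X * Y * Z)) =
  n1 * (p0 * p1 * p2) * (n2 * (q0 * q1 * q2)) * (S' * D).
Proof.
move=> AX BY CZ signs.
transitivity (S * N * ((A * X) * (B * Y) * (C * Z))); first by ring.
rewrite AX BY CZ.
transitivity (S * a * b * c * N * ((p0 * q0) * (p1 * q1) * (p2 * q2))).
  by ring.
by rewrite signs; ring.
Qed.

Section SignedPermutation.
Variables (R : realType) (x y z : R) (ea eb ec d : bool).
Variables (s : seq nat) (n : seq bool).
Hypotheses (x0 : 0 < x) (y0 : 0 < y) (z0 : 0 < z).

Local Notation A :=
  (oct ((-1) ^+ ea * x ^+ 2) ((-1) ^+ eb * y ^+ 2) ((-1) ^+ ec * z ^+ 2)).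
Local Notation B := (oct 1 1 ((-1) ^+ d : R)).

Definition sp_weight (p : nat) : R :=
  (-1) ^+ nth false n p * (x ^+ bit 0 p * y ^+ bit 1 p * z ^+ bit 2 p).

(** It is enough to compare products of basis vectors.  There the powers of
    x, y, z balance because x^(p0 xor q0) (x^2)^(p0 q0) is x^p0 x^q0; only
    signs are left. *)
Lemma signed_perm_iso (v : 7.-tuple B) :
  signed_perm_hom ea eb ec d s n ->
  (forall k : 'I_7,
     tnth v k = sp_weight k.+1 *: oct_f 1 1 ((-1) ^+ d) (nth 0%N s k.+1)) ->
  alg_iso (@oct_ext R _ _ _ B v : A -> B).
Proof.
move=> /andP[sP /allP sn] vE.
have /allP/(_ 0%N isT)/andP[/eqP s0 /eqP n0] := sn 0%N isT.
have {}s0 : nth 0%N s 0 = 0%N by rewrite s0 /xor8 !addbb.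
have {}n0 : nth false n 0 = false.
  by move: n0; rewrite s0 !andbF addbb.
have hl := @oct_ext_linear R _ _ _ B v : linear (oct_ext v : A -> B).
have sz : size s = 8 by rewrite (perm_size sP).
have slt p : (p < 8)%N -> (nth 0%N s p < 8)%N.
  move=> p8; have : nth 0%N s p \in iota 0 8.
    by rewrite -(perm_mem sP) mem_nth // sz.
  by rewrite mem_iota.
have hb p : (p < 8)%N ->
    (oct_ext v : A -> B) (oct_e R p) = sp_weight p *: oct_e R (nth 0%N s p).
  case: p => [_|p p7].
    rewrite s0 /sp_weight n0 !expr0 !mulr1 scale1r.
    exact: (@oct_ext1 R _ _ _ B v).
  by have := @oct_ext_f R _ _ _ B v (Ordinal (p7 : p < 7)%N); rewrite vE; apply.
have w0 p : sp_weight p != 0.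
  by rewrite /sp_weight !mulf_neq0 ?signr_eq0 ?expf_neq0 ?gt_eqF.
split=> //.
- pose s' (p : 'I_8) := inord (nth 0%N s p) : 'I_8.
  have s'E p : s' p = nth 0%N s p :> nat by rewrite inordK // slt.
  apply: (@monomial_bijective R _ s' (fun p => sp_weight p)) => //.
    move=> p q /(congr1 val); rewrite /= !s'E => /eqP.
    rewrite nth_uniq ?sz ?(perm_uniq sP) ?iota_uniq //.
    by move/eqP/val_inj.
  by move=> p; rewrite s'E; apply: hb.
- exact: oct_ext1.
apply: oct_multiplicative => // p q; rewrite /oct_f !hb //.
have inI (i : 'I_8) : (i : nat) \in iota 0 8 by rewrite mem_iota ltn_ord.
have /allP/(_ _ (inI q))/andP[/eqP sx /eqP sg] := sn _ (inI p).
rewrite -[ua_mul (_ : A) _]/(oct_mul _ _ _ _ _) oct_mul_e // oct_tabE //.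
rewrite (linear_scale R A B _ _ _ hl) hb ?xor8_lt8 //.
rewrite (linear_scale R B B _ _ _ (ua_mul_linearl _)).
rewrite (linear_scale R B B _ _ _ (ua_mul_linearr _)).
rewrite -[ua_mul (_ : B) _]/(oct_mul _ _ _ _ _) oct_mul_e ?slt //.
rewrite oct_tabE ?slt //.
rewrite sx !scalerA; congr (_ *: _).
rewrite /sp_weight !bit_xor8 // !expr1n !mul1r.
have -> (u : bool) : ((-1) ^+ d) ^+ u = (-1) ^+ (d && u) :> R.
  by case: d; case: u; rewrite /= ?expr0 ?expr1.
apply: collect_signs; try exact: sqr_expr_addb.
by rewrite -!signr_addb; congr (_ ^+ nat_of_bool _).
Qed.

End SignedPermutation.

(** * Square roots of the parameters *)

Lemma pos_is_sqr (R : realType) (a : R) :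
  0 < a -> exists x : R, 0 < x /\ a = (-1) ^+ false * x ^+ 2.
Proof.
move=> a0; exists (Num.sqrt a).
by rewrite sqrtr_gt0 expr0 mul1r sqr_sqrtr // ltW.
Qed.

Lemma neg_is_opp_sqr (R : realType) (a : R) :
  a < 0 -> exists x : R, 0 < x /\ a = (-1) ^+ true * x ^+ 2.
Proof.
move=> a0; exists (Num.sqrt (- a)).
by rewrite sqrtr_gt0 oppr_gt0 expr1 mulN1r sqr_sqrtr ?opprK // oppr_ge0 ltW.
Qed.

Lemma sqrt_eq (R : realType) (u w : R) : 0 < w -> u = w ^+ 2 -> Num.sqrt u = w.
Proof. by move=> w0 ->; rewrite sqrtr_sqr gtr0_norm. Qed.

(** Checks the seven values of a signed permutation: the monomial in x, y, z is
    positive, so it is the square root of its square, which is the product of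
    parameters under the root. *)
Ltac signed_perm_values :=
  case=> [[|[|[|[|[|[|[|]]]]]]] //= k7]; rewrite (tnth_nth 0) /sp_weight /bit /=;
  rewrite ?(expr0, expr1, mul1r, mulr1, mulN1r, scaleNr);
  do ?congr (- _); congr (_ *: _);
  (apply: sqrt_eq; [by rewrite ?mulr_gt0|by ring]).

Lemma octA1_iso (R : realType) (a b c : R) :
  0 < a -> 0 < b -> 0 < c -> alg_iso (octA1 a b c).
Proof.
move=> /pos_is_sqr[x [x0 ->]] /pos_is_sqr[y [y0 ->]] /pos_is_sqr[z [z0 ->]].
apply: (signed_perm_iso R x y z false false false false
  [:: 0; 1; 2; 3; 4; 5; 6; 7] [::]) => //.
by signed_perm_values.
Qed.

Lemma octA2_iso (R : realType) (a b c : R) :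
  0 < a -> 0 < b -> c < 0 -> alg_iso (octA2 a b c).
Proof.
move=> /pos_is_sqr[x [x0 ->]] /pos_is_sqr[y [y0 ->]] /neg_is_opp_sqr[z [z0 ->]].
apply: (signed_perm_iso R x y z false false true true
  [:: 0; 1; 2; 3; 4; 5; 6; 7] [::]) => //.
by signed_perm_values.
Qed.

Lemma octA3_iso (R : realType) (a b c : R) :
  0 < a -> b < 0 -> 0 < c -> alg_iso (octA3 a b c).
Proof.
move=> /pos_is_sqr[x [x0 ->]] /neg_is_opp_sqr[y [y0 ->]] /pos_is_sqr[z [z0 ->]].
apply: (signed_perm_iso R x y z false true false true
  [:: 0; 1; 4; 5; 2; 3; 6; 7]
  [:: false; false; false; false; false; false; true; true]) => //.
by signed_perm_values.
Qed.

Lemma octA4_iso (R : realType) (a b c : R) :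
  0 < a -> b < 0 -> c < 0 -> alg_iso (octA4 a b c).
Proof.
move=> /pos_is_sqr[x [x0 ->]] /neg_is_opp_sqr[y [y0 ->]]
  /neg_is_opp_sqr[z [z0 ->]].
apply: (signed_perm_iso R x y z false true true true
  [:: 0; 1; 4; 5; 6; 7; 2; 3]
  [:: false; false; false; false; false; true; true; false]) => //.
by signed_perm_values.
Qed.

Lemma octA5_iso (R : realType) (a b c : R) :
  a < 0 -> 0 < b -> 0 < c -> alg_iso (octA5 a b c).
Proof.
move=> /neg_is_opp_sqr[x [x0 ->]] /pos_is_sqr[y [y0 ->]] /pos_is_sqr[z [z0 ->]].
apply: (signed_perm_iso R x y z true false false true
  [:: 0; 4; 1; 5; 2; 6; 3; 7]
  [:: false; false; false; true; false; true; false; false]) => //.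
by signed_perm_values.
Qed.

Lemma octA6_iso (R : realType) (a b c : R) :
  a < 0 -> 0 < b -> c < 0 -> alg_iso (octA6 a b c).
Proof.
move=> /neg_is_opp_sqr[x [x0 ->]] /pos_is_sqr[y [y0 ->]] /neg_is_opp_sqr[z [z0 ->]].
apply: (signed_perm_iso R x y z true false true true
  [:: 0; 4; 1; 5; 6; 2; 7; 3]
  [:: false; false; false; true; false; true; true; true]) => //.
by signed_perm_values.
Qed.

Lemma octA7_iso (R : realType) (a b c : R) :
  a < 0 -> b < 0 -> 0 < c -> alg_iso (octA7 a b c).
Proof.
move=> /neg_is_opp_sqr[x [x0 ->]] /neg_is_opp_sqr[y [y0 ->]]
  /pos_is_sqr[z [z0 ->]].
apply: (signed_perm_iso R x y z true true false true
  [:: 0; 4; 5; 1; 2; 6; 7; 3]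
  [:: false; false; false; true; false; true; true; true]) => //.
by signed_perm_values.
Qed.

Lemma octA8_iso (R : realType) (a b c : R) :
  a < 0 -> b < 0 -> c < 0 -> alg_iso (octA8 a b c).
Proof.
move=> /neg_is_opp_sqr[x [x0 ->]] /neg_is_opp_sqr[y [y0 ->]]
  /neg_is_opp_sqr[z [z0 ->]].
apply: (signed_perm_iso R x y z true true true true
  [:: 0; 4; 5; 1; 6; 2; 3; 7]
  [:: false; false; false; true; false; true; false; false]) => //.
by signed_perm_values.
Qed.

Theorem mainTheorem2 (R : realType) (alpha beta gamma : R)
    (alpha0 : alpha != 0) (beta0 : beta != 0) (gamma0 : gamma != 0) :
  (alg_isomorphic (oct alpha beta gamma) (oct 1 1 1) \/
   alg_isomorphic (oct alpha beta gamma) (oct 1 1 (-1)))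
  /\ (0 < alpha -> 0 < beta -> 0 < gamma ->
      alg_iso (octA1 alpha beta gamma))
  /\ (0 < alpha -> 0 < beta -> gamma < 0 ->
      alg_iso (octA2 alpha beta gamma))
  /\ (0 < alpha -> beta < 0 -> 0 < gamma ->
      alg_iso (octA3 alpha beta gamma))
  /\ (0 < alpha -> beta < 0 -> gamma < 0 ->
      alg_iso (octA4 alpha beta gamma))
  /\ (alpha < 0 -> 0 < beta -> 0 < gamma ->
      alg_iso (octA5 alpha beta gamma))
  /\ (alpha < 0 -> 0 < beta -> gamma < 0 ->
      alg_iso (octA6 alpha beta gamma))
  /\ (alpha < 0 -> beta < 0 -> 0 < gamma ->
      alg_iso (octA7 alpha beta gamma))
  /\ (alpha < 0 -> beta < 0 -> gamma < 0 ->
      alg_iso (octA8 alpha beta gamma)).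
Proof.
refine (conj _ (conj (octA1_iso _ _ _ _) (conj (octA2_iso _ _ _ _)
  (conj (octA3_iso _ _ _ _) (conj (octA4_iso _ _ _ _) (conj (octA5_iso _ _ _ _)
  (conj (octA6_iso _ _ _ _) (conj (octA7_iso _ _ _ _) (octA8_iso _ _ _ _))))))))).
case: (ltgtP alpha 0) alpha0 => // a0 _; case: (ltgtP beta 0) beta0 => // b0 _;
  case: (ltgtP gamma 0) gamma0 => // c0 _.
- by right; exists (octA8 alpha beta gamma); apply: octA8_iso.
- by right; exists (octA7 alpha beta gamma); apply: octA7_iso.
- by right; exists (octA6 alpha beta gamma); apply: octA6_iso.
- by right; exists (octA5 alpha beta gamma); apply: octA5_iso.
- by right; exists (octA4 alpha beta gamma); apply: octA4_iso.
- by right; exists (octA3 alpha beta gamma); apply: octA3_iso.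
- by right; exists (octA2 alpha beta gamma); apply: octA2_iso.
- by left; exists (octA1 alpha beta gamma); apply: octA1_iso.
Qed.
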